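(* Over $\mathbf{ZF}$, the Axiom of Choice is equivalent to the statement: ''Every morphism of the category $\mathcal{PV}_{\mathrm{unb}}$ is realized as a reduction link.''
   Context: The base theory is $\mathbf{ZF}$ (no choice is assumed). The Axiom of Choice asserts that every family of non-empty sets has a choice function. The category $\mathcal{PV}_{\mathrm{unb}}$ has as objects the triples $P=(I,S,\sigma)$ where $I$ and $S$ are non-empty sets (of arbitrary size) and $\sigma\subseteq I\times S$ is a relation such that $(\forall z\in I)(\exists s\in S)\,[z\,\sigma\,s]$ and $(\forall s\in S)(\exists z\in I)\,[\neg(z\,\sigma\,s)]$. A morphism of $\mathcal{PV}_{\mathrm{unb}}$ from $P'=(I',S',\sigma')$ to $P=(I,S,\sigma)$ is a pair of functions $(f,F)$ with $f:I\to I'$ and $F:S'\to S$ such that $$(\forall z\in I)(\forall t\in S')\,[\,f(z)\,\sigma'\,t\longrightarrow z\,\sigma\,F(t)\,].$$ A solution function for $P=(I,S,\sigma)$ is a function $g:I\to S$ with $z\,\sigma\,g(z)$ for every $z\in I$. A link from $P=(I,S,\sigma)$ to $P'=(I',S',\sigma')$ is a pair of functions $(f,F)$ with $f:I\to I'$ and $F:S'\to S$. Such a link is a reduction link of $P$ to $P'$ if for every solution function $g$ of $P'$ the composite $F\circ g\circ f$ is a solution function for $P$. (If $P'$ has no solution function, every link from $P$ to $P'$ is vacuously a reduction link.) A morphism $(f,F)$ of $\mathcal{PV}_{\mathrm{unb}}$ from $P'$ to $P$ is realized as a reduction link if the statement ''$(f,F)$ is a reduction link from $P$ to $P'$'' holds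 non-vacuously, that is, $(f,F)$ is a reduction link of $P$ to $P'$ and $P'$ has at least one solution function. *)

(* Defs.v *)
(* "Over ZF" is rendered semantically: a statement of set theory holds over ZF
   when it holds in every first-order structure (V, E) satisfying the axioms of
   ZF. Everything below is therefore phrased inside such a structure: sets,
   relations and functions are elements of [V], and quantifiers range over [V].
   In particular no choice principle of the ambient logic is inherited by (V, E). *)

(* First-order formulas of the language of set theory, with de Bruijn indices
   ([f_all] and [f_ex] bind index 0); needed for the axiom schemas only. *)
Inductive formula : Type :=
| f_mem (i j : nat)
| f_eq (i j : nat)
| f_not (p : formula)
| f_and (p q : formula)
| f_or (p q : formula)
| f_imp (p q : formula)
| f_all (p : formula)
| f_ex (p : formula).

Definition scons {V : Type} (x : V) (env : nat -> V) (n : nat) : V :=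
  match n with O => x | S k => env k end.

Fixpoint sat {V : Type} (E : V -> V -> Prop) (env : nat -> V) (p : formula)
  : Prop :=
  match p with
  | f_mem i j => E (env i) (env j)
  | f_eq i j => env i = env j
  | f_not q => ~ sat E env q
  | f_and q r => sat E env q /\ sat E env r
  | f_or q r => sat E env q \/ sat E env r
  | f_imp q r => sat E env q -> sat E env r
  | f_all q => forall x : V, sat E (scons x env) q
  | f_ex q => exists x : V, sat E (scons x env) q
  end.

Section Structure.

Context {V : Type} (E : V -> V -> Prop).

Local Notation "x ∈ y" := (E x y) (at level 70, no associativity).

Definition is_empty (x : V) : Prop := forall z, ~ z ∈ x.

(* p = {a, b} *)
Definition is_upair (p a b : V) : Prop := forall z, z ∈ p <-> z = a \/ z = b.

(* y = x ∪ {x} *)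
Definition is_succ (y x : V) : Prop := forall z, z ∈ y <-> z ∈ x \/ z = x.

(* In the two schemas the environment [env] supplies the parameters. *)
Record ZF_model : Prop := {
  zf_extensionality :
    forall x y, (forall z, z ∈ x <-> z ∈ y) -> x = y;
  zf_foundation :
    forall x, (exists y, y ∈ x) -> exists y, y ∈ x /\ ~ exists z, z ∈ y /\ z ∈ x;
  zf_pairing :
    forall a b, exists p, is_upair p a b;
  zf_union :
    forall x, exists u, forall z, z ∈ u <-> exists y, y ∈ x /\ z ∈ y;
  zf_power_set :
    forall x, exists u, forall y, y ∈ u <-> forall z, z ∈ y -> z ∈ x;
  zf_infinity :
    exists w, (exists e, is_empty e /\ e ∈ w) /\
      (forall x, x ∈ w -> exists y, is_succ y x /\ y ∈ w);
  zf_separation :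
    forall (phi : formula) (env : nat -> V) (a : V),
    exists b, forall x, x ∈ b <-> x ∈ a /\ sat E (scons x env) phi;
  zf_replacement :
    forall (phi : formula) (env : nat -> V) (a : V),
    (forall x, x ∈ a -> forall y y',
       sat E (scons x (scons y env)) phi ->
       sat E (scons x (scons y' env)) phi -> y = y') ->
    exists b, forall y, y ∈ b <->
      exists x, x ∈ a /\ sat E (scons x (scons y env)) phi
}.

(* Kuratowski pair: p = {{a}, {a, b}} *)
Definition is_opair (p a b : V) : Prop :=
  exists u v, is_upair u a a /\ is_upair v a b /\ is_upair p u v.

(* (a, b) ∈ r; for a function r this reads r(a) = b *)
Definition related (r a b : V) : Prop := exists p, is_opair p a b /\ p ∈ r.

(* r ⊆ A × B *)
Definition is_relation (r A B : V) : Prop :=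
  forall p, p ∈ r -> exists a b, a ∈ A /\ b ∈ B /\ is_opair p a b.

(* f : A -> B *)
Definition is_function (f A B : V) : Prop :=
  is_relation f A B /\ forall a, a ∈ A -> exists! b, related f a b.

(* h = g ∘ f *)
Definition is_composite (h g f : V) : Prop :=
  forall p, p ∈ h <->
    exists x y z, is_opair p x z /\ related f x y /\ related g y z.

(* For every family (X_i)_{i ∈ I} of non-empty sets there is a function c with
   domain I such that c(i) ∈ X_i for every i ∈ I. *)
Definition axiom_of_choice : Prop :=
  forall I X : V,
    (exists B, is_function X I B) ->
    (forall i Xi, related X i Xi -> exists x, x ∈ Xi) ->
    exists c, (exists C, is_function c I C) /\
      forall i Xi x, related X i Xi -> related c i x -> x ∈ Xi.

Record PVunb : Type := {
  inst : V;
  sol : V;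
  rel : V;
  inst_nonempty : exists z, z ∈ inst;
  sol_nonempty : exists s, s ∈ sol;
  rel_relation : is_relation rel inst sol;
  rel_solvable : forall z, z ∈ inst -> exists s, s ∈ sol /\ related rel z s;
  rel_no_universal :
    forall s, s ∈ sol -> exists z, z ∈ inst /\ ~ related rel z s
}.

(* Morphisms from P' to P; [hom_inst] is f : I -> I' and [hom_sol] is
   F : S' -> S. *)
Record PVunb_hom (P' P : PVunb) : Type := {
  hom_inst : V;
  hom_sol : V;
  hom_inst_function : is_function hom_inst (inst P) (inst P');
  hom_sol_function : is_function hom_sol (sol P') (sol P);
  hom_compat : forall z t, z ∈ inst P -> t ∈ sol P' ->
    forall fz Ft, related hom_inst z fz -> related hom_sol t Ft ->
    related (rel P') fz t -> related (rel P) z Ft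
}.

Definition is_solution_function (P : PVunb) (g : V) : Prop :=
  is_function g (inst P) (sol P) /\
  forall z gz, z ∈ inst P -> related g z gz -> related (rel P) z gz.

(* (f, F) is a link from P to P' *)
Definition is_link (P P' : PVunb) (f F : V) : Prop :=
  is_function f (inst P) (inst P') /\ is_function F (sol P') (sol P).

Definition is_reduction_link (P P' : PVunb) (f F : V) : Prop :=
  is_link P P' f F /\
  forall g, is_solution_function P' g ->
    exists gf h, is_composite gf g f /\ is_composite h F gf /\
      is_solution_function P h.

Definition realized_as_reduction_link (P' P : PVunb) (m : PVunb_hom P' P)
  : Prop :=
  is_reduction_link P P' (hom_inst P' P m) (hom_sol P' P m) /\
  exists g, is_solution_function P' g.

End Structure.

Arguments realized_as_reduction_link {V E P' P} m.

(* Main.v *)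
Require Import Defs.
From Stdlib Require Import Classical.

(** Fix a model of ZF.

    Choice implies realization.  For a problem [(I, S, rel)], a solution function
    is exactly a choice function for the family [i |-> {s in S : i rel s}], whose
    members are non-empty because every instance is solvable.  So under choice the
    source [P'] of a morphism [(f, F)] has a solution function.  That [(f, F)] is
    a reduction link holds for every morphism: if [g] solves [P'], then
    [f(z) rel' g(f(z))], and compatibility turns this into [z rel F(g(f(z)))].

    Realization implies choice.  Let [X_i], for [i] in [I], be non-empty sets.  If
    some [x] lies in all of them, the constant function with value [x] is a choice
    function; this also disposes of [I] empty.  Otherwise membership between [I]
    and any set [S] including all the [X_i] is a relation without universal
    solution, hence an object of the category, and its identity morphism can be
    realized only if it has a solution function, which is a choice function for the
    family.

    All sets involved must be shown to exist inside the model, where only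
    first-order separation is at hand: [graph_exists] turns a definable and bounded
    binary relation into a set of pairs, and every relation and function below is
    obtained from it. *)

(** * First-order formulas for pairs *)

(** The formulas follow the shape of the predicates they express, so that their
    satisfaction unfolds, by computation alone, to these predicates. *)
Definition fm_iff (p q : formula) : formula := f_and (f_imp p q) (f_imp q p).

Definition fm_upair (p a b : nat) : formula :=
  f_all (fm_iff (f_mem 0 (S p)) (f_or (f_eq 0 (S a)) (f_eq 0 (S b)))).

Definition fm_opair (p a b : nat) : formula :=
  f_ex (f_ex (f_and (fm_upair 1 (S (S a)) (S (S a)))
    (f_and (fm_upair 0 (S (S a)) (S (S b))) (fm_upair (S (S p)) 1 0)))).

Definition fm_related (r a b : nat) : formula :=
  f_ex (f_and (fm_opair 0 (S a) (S b)) (f_mem 0 (S r))).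

Section Model.

Context {V : Type} {E : V -> V -> Prop} (hZF : ZF_model E).

Local Notation "x ∈ y" := (E x y) (at level 70, no associativity).

(** * Ordered pairs *)

Lemma opair_exists (a b : V) : exists p, is_opair E p a b.
Proof.
  destruct (zf_pairing E hZF a a) as [u Hu].
  destruct (zf_pairing E hZF a b) as [v Hv].
  destruct (zf_pairing E hZF u v) as [p Hp].
  exists p, u, v; auto.
Qed.

Lemma upair_inj (p a b c d : V) : is_upair E p a b -> is_upair E p c d ->
  (a = c /\ b = d) \/ (a = d /\ b = c).
Proof.
  intros H H'.
  assert (Ha : a = c \/ a = d) by (apply H', H; auto).
  assert (Hb : b = c \/ b = d) by (apply H', H; auto).
  assert (Hc : c = a \/ c = b) by (apply H, H'; auto).
  assert (Hd : d = a \/ d = b) by (apply H, H'; auto).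
  clear H H'.
  destruct Ha, Hb, Hc, Hd; subst; auto.
Qed.

Lemma opair_inj (p a b a' b' : V) :
  is_opair E p a b -> is_opair E p a' b' -> a = a' /\ b = b'.
Proof.
  intros (u & v & Hu & Hv & Hp) (u' & v' & Hu' & Hv' & Hp').
  destruct (upair_inj _ _ _ _ _ Hp Hp') as [[-> ->] | [-> ->]];
    [ destruct (upair_inj _ _ _ _ _ Hu Hu') as [[] | []];
      destruct (upair_inj _ _ _ _ _ Hv Hv') as [[] | []]
    | destruct (upair_inj _ _ _ _ _ Hu Hv') as [[] | []];
      destruct (upair_inj _ _ _ _ _ Hv Hu') as [[] | []] ];
    subst; auto.
Qed.

(** * Graphs of definable relations *)

(** The third slot of the environment is left to an arbitrary value because, in
    the separation instance of [graph_exists], the pair under test sits there. *)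
Definition definable (R : V -> V -> Prop) : Prop :=
  exists (phi : formula) (env : nat -> V), forall p a b,
    sat E (scons b (scons a (scons p env))) phi <-> R a b.

(** A Kuratowski pair of an element of [A] and one of [B] lies in the double power
    set of [A ∪ B]; this is the set that separation cuts graphs from. *)
Lemma pairs_bounded (A B : V) :
  exists W, forall p a b, a ∈ A -> b ∈ B -> is_opair E p a b -> p ∈ W.
Proof.
  destruct (zf_pairing E hZF A B) as [AB HAB].
  destruct (zf_union E hZF AB) as [U HU].
  destruct (zf_power_set E hZF U) as [PU HPU].
  destruct (zf_power_set E hZF PU) as [PPU HPPU].
  exists PPU; intros p a b Ha Hb (u & v & Hu & Hv & Hp).
  assert (HaU : a ∈ U) by (apply HU; exists A; split; [apply HAB |]; auto).
  assert (HbU : b ∈ U) by (apply HU; exists B; split; [apply HAB |]; auto).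
  apply HPPU; intros w Hw; apply HPU; intros z Hz.
  apply Hp in Hw; destruct Hw as [-> | ->].
  - apply Hu in Hz; destruct Hz as [-> | ->]; assumption.
  - apply Hv in Hz; destruct Hz as [-> | ->]; assumption.
Qed.

Lemma graph_exists (R : V -> V -> Prop) (A B : V) :
  definable R -> (forall a b, R a b -> a ∈ A /\ b ∈ B) ->
  exists r, forall p, p ∈ r <-> exists a b, is_opair E p a b /\ R a b.
Proof.
  intros (phi & env & Hphi) HAB.
  destruct (pairs_bounded A B) as [W HW].
  destruct (zf_separation E hZF (f_ex (f_ex (f_and (fm_opair 2 1 0) phi))) env W)
    as [r Hr].
  exists r; intro p; rewrite (Hr p); clear Hr; split.
  - intros (_ & a & b & Hp & Hab).
    exists a, b; split; [exact Hp | exact (proj1 (Hphi p a b) Hab)].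
  - intros (a & b & Hp & Hab); destruct (HAB a b Hab) as [Ha Hb]; split.
    + exact (HW p a b Ha Hb Hp).
    + exists a, b; split; [exact Hp | exact (proj2 (Hphi p a b) Hab)].
Qed.

Lemma relation_exists (R : V -> V -> Prop) (A B : V) :
  definable R -> (forall a b, R a b -> a ∈ A /\ b ∈ B) ->
  exists r, is_relation E r A B /\ forall a b, related E r a b <-> R a b.
Proof.
  intros HR HAB; destruct (graph_exists R A B HR HAB) as [r Hr].
  exists r; split.
  - intros p Hp; apply Hr in Hp; destruct Hp as (a & b & Hp & Hab).
    exists a, b; destruct (HAB a b Hab); auto.
  - intros a b; split.
    + intros (p & Hp & Hpr); apply Hr in Hpr.
      destruct Hpr as (a' & b' & Hp' & Hab).
      destruct (opair_inj _ _ _ _ _ Hp Hp') as [-> ->]; exact Hab.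
    + intro Hab; destruct (opair_exists a b) as [p Hp].
      exists p; split; [exact Hp |]; apply Hr; exists a, b; auto.
Qed.

Lemma function_exists (R : V -> V -> Prop) (A B : V) :
  definable R -> (forall a b, R a b -> a ∈ A /\ b ∈ B) ->
  (forall a, a ∈ A -> exists! b, R a b) ->
  exists f, is_function E f A B /\ forall a b, related E f a b <-> R a b.
Proof.
  intros HR HAB Hfun; destruct (relation_exists R A B HR HAB) as (f & Hrel & Hf).
  exists f; split; [split; [exact Hrel |] | exact Hf].
  intros a Ha; destruct (Hfun a Ha) as (b & Hb & Huniq).
  exists b; split; [apply Hf; exact Hb |].
  intros b' Hb'; apply Huniq, Hf; exact Hb'.
Qed.

Lemma related_in (r A B a b : V) :
  is_relation E r A B -> related E r a b -> a ∈ A /\ b ∈ B.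
Proof.
  intros Hr (p & Hp & Hpr); destruct (Hr p Hpr) as (a' & b' & Ha & Hb & Hp').
  destruct (opair_inj _ _ _ _ _ Hp Hp') as [-> ->]; auto.
Qed.

Lemma function_value_unique (f A B a b b' : V) :
  is_function E f A B -> related E f a b -> related E f a b' -> b = b'.
Proof.
  intros [Hrel Hfun] H H'.
  destruct (Hfun a (proj1 (related_in _ _ _ _ _ Hrel H))) as (c & _ & Hc).
  rewrite <- (Hc b H), <- (Hc b' H'); reflexivity.
Qed.

Lemma identity_exists (A : V) :
  exists f, is_function E f A A /\
    forall a b, related E f a b <-> a ∈ A /\ a = b.
Proof.
  apply function_exists.
  - exists (f_and (f_mem 1 3) (f_eq 1 0)), (fun _ => A); reflexivity.
  - intros a b [Ha <-]; auto.
  - intros a Ha; exists a; split; [auto |]; intros b [_ Hb]; exact Hb.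
Qed.

Lemma constant_function_exists (A x : V) :
  exists f, (exists B, is_function E f A B) /\
    forall a b, related E f a b -> b = x.
Proof.
  destruct (zf_pairing E hZF x x) as [B HB].
  destruct (function_exists (fun a b => a ∈ A /\ b = x) A B) as (f & Hf & Hval).
  - exists (f_and (f_mem 1 3) (f_eq 0 4)), (scons A (fun _ => x)); reflexivity.
  - intros a b [Ha ->]; split; [exact Ha | apply HB; auto].
  - intros a Ha; exists x; split; [auto |]; intros b [_ Hb]; auto.
  - exists f; split; [exists B; exact Hf |].
    intros a b Hab; apply Hval in Hab; exact (proj2 Hab).
Qed.

Lemma composite_exists (f g A B C : V) :
  is_function E f A B -> is_function E g B C ->
  exists h, is_composite E h g f /\ is_function E h A C /\
    forall x z, related E h x z ->
      exists y, related E f x y /\ related E g y z.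
Proof.
  intros Hf Hg.
  set (R := fun x z => exists y, related E f x y /\ related E g y z).
  assert (HAC : forall x z, R x z -> x ∈ A /\ z ∈ C).
  { intros x z (y & Hxy & Hyz); split.
    - exact (proj1 (related_in _ _ _ _ _ (proj1 Hf) Hxy)).
    - exact (proj2 (related_in _ _ _ _ _ (proj1 Hg) Hyz)). }
  destruct (graph_exists R A C) as [h Hh].
  - exists (f_ex (f_and (fm_related 4 2 0) (fm_related 5 0 1))),
      (scons f (fun _ => g)); reflexivity.
  - exact HAC.
  - assert (Hval : forall x z, related E h x z <-> R x z).
    { intros x z; split.
      - intros (p & Hp & Hph); apply Hh in Hph.
        destruct Hph as (x' & z' & Hp' & Hxz).
        destruct (opair_inj _ _ _ _ _ Hp Hp') as [-> ->]; exact Hxz.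
      - intro Hxz; destruct (opair_exists x z) as [p Hp].
        exists p; split; [exact Hp |]; apply Hh; exists x, z; auto. }
    exists h; split; [| split; [split |]].
    + intro p; rewrite (Hh p); split.
      * intros (x & z & Hp & y & Hxy & Hyz); exists x, y, z; auto.
      * intros (x & y & z & Hp & Hxy & Hyz).
        exists x, z; split; [exact Hp | exists y; auto].
    + intros p Hp; apply Hh in Hp; destruct Hp as (x & z & Hp & Hxz).
      destruct (HAC x z Hxz); exists x, z; auto.
    + intros x Hx.
      destruct (proj2 Hf x Hx) as (y & Hxy & _).
      destruct (proj2 Hg y (proj2 (related_in _ _ _ _ _ (proj1 Hf) Hxy)))
        as (z & Hyz & _).
      exists z; split; [apply Hval; exists y; auto |].
      intros z' Hz'; apply Hval in Hz'; destruct Hz' as (y' & Hxy' & Hyz').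
      rewrite <- (function_value_unique _ _ _ _ _ _ Hf Hxy Hxy') in Hyz'.
      exact (function_value_unique _ _ _ _ _ _ Hg Hyz Hyz').
    + intros x z Hxz; apply Hval; exact Hxz.
Qed.

(** * Choice gives realization *)

(** Choice in the model speaks only of families that are themselves sets, so the
    assignment [i |-> {b in B : i r b}] has to be an element of the model; its
    values lie in the power set of [B]. *)
Lemma fibres_exist (r A B : V) :
  is_relation E r A B ->
  exists X, (exists D, is_function E X A D) /\
    forall i Xi, related E X i Xi ->
      i ∈ A /\ forall b, b ∈ Xi <-> related E r i b.
Proof.
  intro Hr.
  destruct (zf_power_set E hZF B) as [PB HPB].
  destruct (function_exists
    (fun i T => i ∈ A /\ forall b, b ∈ T <-> related E r i b) A PB)
    as (X & HX & Hval).
  - exists (f_and (f_mem 1 3)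
        (f_all (fm_iff (f_mem 0 1) (fm_related 5 2 0)))),
      (scons A (fun _ => r)); reflexivity.
  - intros i T [Hi HT]; split; [exact Hi |].
    apply HPB; intros b Hb; apply HT in Hb.
    exact (proj2 (related_in _ _ _ _ _ Hr Hb)).
  - intros i Hi.
    destruct (zf_separation E hZF (fm_related 2 1 0) (scons i (fun _ => r)) B)
      as [T HT].
    assert (HTr : forall b, b ∈ T <-> related E r i b).
    { intro b; rewrite (HT b); split.
      - intros [_ Hb]; exact Hb.
      - intro Hb; split; [| exact Hb].
        exact (proj2 (related_in _ _ _ _ _ Hr Hb)). }
    exists T; split; [auto |].
    intros T' [_ HT']; apply (zf_extensionality E hZF); intro b.
    rewrite (HTr b), (HT' b); reflexivity.
  - exists X; split; [exists PB; exact HX |].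
    intros i Xi Hi; apply Hval; exact Hi.
Qed.

(** Solvability of the instances is non-emptiness of the fibres of the relation. *)
Lemma solution_function_exists (P : PVunb E) :
  axiom_of_choice E -> exists g, is_solution_function E P g.
Proof.
  intro AC.
  pose proof (rel_relation E P) as Hrel.
  destruct (fibres_exist _ _ _ Hrel) as (X & (D & HX) & Hfib).
  destruct (AC (inst E P) X) as (g & (C & Hg) & Hchoice).
  - exists D; exact HX.
  - intros i Xi Hi; destruct (Hfib i Xi Hi) as [HiI HXi].
    destruct (rel_solvable E P i HiI) as (s & _ & Hs).
    exists s; apply HXi; exact Hs.
  - assert (Hsol : forall i s, i ∈ inst E P -> related E g i s ->
      related E (rel E P) i s).
    { intros i s Hi His; destruct (proj2 HX i Hi) as (Xi & HXi & _).
      apply (proj2 (Hfib i Xi HXi)); exact (Hchoice i Xi s HXi His). }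
    (* The codomain [C] handed out by choice has to be replaced by the set of
       solutions of [P]. *)
    exists g; split; [split; [| exact (proj2 Hg)] | exact Hsol].
    intros p Hp; destruct (proj1 Hg p Hp) as (i & s & Hi & _ & His).
    exists i, s; split; [exact Hi |]; split; [| exact His].
    apply (related_in _ _ _ i s Hrel), (Hsol i s Hi); exists p; auto.
Qed.

(** Compatibility of a morphism is used at [t = g(f(z))]. *)
Lemma morphism_is_reduction_link (P' P : PVunb E) (m : PVunb_hom E P' P) :
  is_reduction_link E P P' (hom_inst E P' P m) (hom_sol E P' P m).
Proof.
  destruct m as [f F Hf HF Hcompat]; cbn.
  split; [split; assumption |].
  intros g [Hg Hsol].
  destruct (composite_exists _ _ _ _ _ Hf Hg) as (gf & Hcgf & Hgf & Hgfval).
  destruct (composite_exists _ _ _ _ _ Hgf HF) as (h & Hch & Hh & Hhval).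
  exists gf, h; split; [exact Hcgf |]; split; [exact Hch |]; split; [exact Hh |].
  intros z s Hz Hzs.
  destruct (Hhval z s Hzs) as (t & Hzt & Hts).
  destruct (Hgfval z t Hzt) as (fz & Hzf & Hfzt).
  apply (Hcompat z t Hz (proj2 (related_in _ _ _ _ _ (proj1 Hg) Hfzt)) fz s Hzf Hts).
  apply Hsol; [| exact Hfzt].
  exact (proj2 (related_in _ _ _ _ _ (proj1 Hf) Hzf)).
Qed.

(** * Realization gives choice *)

Lemma identity_morphism_exists (P : PVunb E) : inhabited (PVunb_hom E P P).
Proof.
  destruct (identity_exists (inst E P)) as (f & Hf & Hfval).
  destruct (identity_exists (sol E P)) as (F & HF & HFval).
  constructor; refine (Build_PVunb_hom _ P P f F Hf HF _).
  intros z t _ _ fz Ft Hz Ht Hrel.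
  apply Hfval in Hz; destruct Hz as [_ <-].
  apply HFval in Ht; destruct Ht as [_ <-].
  exact Hrel.
Qed.

(** The membership problem of a family: an instance is an index [i], and its
    solutions are the elements of [X_i].  That no [x] lies in every [X_i] is what
    makes it an object of the category; in particular it forces [I] to be
    non-empty. *)
Lemma membership_problem_exists (I X B : V) :
  is_function E X I B ->
  (forall i Xi, related E X i Xi -> exists x, x ∈ Xi) ->
  (~ exists x, forall i Xi, related E X i Xi -> x ∈ Xi) ->
  exists P : PVunb E, inst E P = I /\
    forall i x, related E (rel E P) i x ->
      exists Xi, related E X i Xi /\ x ∈ Xi.
Proof.
  intros HX Hne Hno.
  destruct (zf_union E hZF B) as [U HU].
  destruct (relation_exists
    (fun i x => exists Xi, related E X i Xi /\ x ∈ Xi) I U) as (r & Hr & Hval).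
  { exists (f_ex (f_and (fm_related 4 2 0) (f_mem 1 0))), (fun _ => X).
    reflexivity. }
  { intros i x (Xi & HXi & Hx).
    destruct (related_in _ _ _ _ _ (proj1 HX) HXi) as [Hi HXiB].
    split; [exact Hi |]; apply HU; exists Xi; auto. }
  assert (Hsolv : forall i, i ∈ I -> exists x, x ∈ U /\ related E r i x).
  { intros i Hi; destruct (proj2 HX i Hi) as (Xi & HXi & _).
    destruct (Hne i Xi HXi) as [x Hx].
    assert (Hix : related E r i x) by (apply Hval; exists Xi; auto).
    exists x; split; [exact (proj2 (related_in _ _ _ _ _ Hr Hix)) | exact Hix]. }
  assert (Huniv : forall x, exists i, i ∈ I /\ ~ related E r i x).
  { intro x; apply NNPP; intro Hcon; apply Hno; exists x; intros i Xi HXi.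
    apply NNPP; intro Hx; apply Hcon; exists i; split.
    - exact (proj1 (related_in _ _ _ _ _ (proj1 HX) HXi)).
    - intro Hix; apply Hval in Hix; destruct Hix as (Yi & HYi & HxY).
      rewrite (function_value_unique _ _ _ _ _ _ HX HYi HXi) in HxY; auto. }
  (* [Huniv] at any set, here [I] itself, provides an index. *)
  destruct (Huniv I) as (i0 & Hi0 & _).
  destruct (Hsolv i0 Hi0) as (x0 & Hx0 & _).
  unshelve eexists (Build_PVunb E I U r _ _ Hr Hsolv _).
  - exists i0; exact Hi0.
  - exists x0; exact Hx0.
  - intros x _; apply Huniv.
  - cbn; split; [reflexivity |]; intros i x; apply Hval.
Qed.

Lemma choice_of_solution_functions :
  (forall P : PVunb E, exists g, is_solution_function E P g) -> axiom_of_choice E.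
Proof.
  intros Hsol I X [B HX] Hne.
  destruct (classic (exists x, forall i Xi, related E X i Xi -> x ∈ Xi))
    as [[x Hx] | Hno].
  - destruct (constant_function_exists I x) as (c & Hc & Hval).
    exists c; split; [exact Hc |].
    intros i Xi y HXi Hy; rewrite (Hval i y Hy); exact (Hx i Xi HXi).
  - destruct (membership_problem_exists I X B HX Hne Hno) as (P & HI & HP).
    destruct (Hsol P) as (g & Hg & Hgsol); rewrite HI in Hg, Hgsol.
    exists g; split; [exists (sol E P); exact Hg |].
    intros i Xi x HXi Hx.
    assert (Hi : i ∈ I) by exact (proj1 (related_in _ _ _ _ _ (proj1 HX) HXi)).
    destruct (HP i x (Hgsol i x Hi Hx)) as (Yi & HYi & HxY).
    rewrite (function_value_unique _ _ _ _ _ _ HX HXi HYi); exact HxY.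
Qed.

End Model.

Theorem theorem3p14 (V : Type) (E : V -> V -> Prop) (hZF : ZF_model E) :
  axiom_of_choice E <->
  (forall (P' P : PVunb E) (m : PVunb_hom E P' P),
     realized_as_reduction_link m).
Proof.
  split.
  - intros AC P' P m; split.
    + exact (morphism_is_reduction_link hZF P' P m).
    + exact (solution_function_exists hZF P' AC).
  - intro Hreal; apply (choice_of_solution_functions hZF); intro P.
    destruct (identity_morphism_exists hZF P) as [m].
    exact (proj2 (Hreal P P m)).
Qed.
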